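(* Let $\xi_1,\ldots,\xi_n$ be independent real-valued random variables with finite moments of all positive orders, and suppose that the even order moments $m_{i,2k}=\mathbf{E}[\xi_i^{2k}]$, $i=1,\ldots,n$, satisfy $$m_{i,2k}=\mathcal{O}((2k)^{2a_i k})\quad\text{as } k\to\infty,\quad\text{for } i=1,\ldots,n,$$ where $a_1,\ldots,a_n$ are positive constants. If $a_1+\cdots+a_n\le 1$, then the product $Z_n=\xi_1\cdots\xi_n$ is M-det.
   Context: A random variable $X$ with distribution function $F$ and moments $m_k=\mathbf{E}[X^k]$ (all finite) is called moment determinate (M-det) if $F$ is the only distribution having the moment sequence $\{m_k\}_{k=1}^\infty$. *)

(* Defs.v *)
From HB Require Import structures.
From mathcomp Require Import all_boot all_order all_algebra.
From mathcomp Require Import all_classical all_reals all_analysis.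

Set Implicit Arguments.
Unset Strict Implicit.
Unset Printing Implicit Defensive.

Import Order.TTheory GRing.Theory Num.Theory.
Import numFieldNormedType.Exports.

Local Open Scope classical_set_scope.
Local Open Scope ring_scope.

(* Taking A i = setT for the indices outside a subset J gives the product rule
   for the subfamily indexed by J. *)
Definition independent_RVs d (T : measurableType d) (R : realType)
    (P : probability T R) (n : nat) (X : 'I_n -> {RV P >-> R}) : Prop :=
  forall A : 'I_n -> set R, (forall i, measurable (A i)) ->
    P (\bigcap_(i in [set: 'I_n]) X i @^-1` A i) =
    (\prod_(i < n) P (X i @^-1` A i))%E.

Definition finite_moments d (T : measurableType d) (R : realType)
    (P : probability T R) (X : T -> R) : Prop :=
  forall k, (0 < k)%N -> P.-integrable [set: T] (fun t => (X t ^+ k)%:E).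

Definition moment d (T : measurableType d) (R : realType)
    (P : probability T R) (X : T -> R) (k : nat) : \bar R :=
  'E_P[fun t => X t ^+ k].

(* The competing distributions are the Borel probability measures nu on R; the
   moments of nu are those of the identity under nu. *)
Definition M_det d (T : measurableType d) (R : realType)
    (P : probability T R) (X : {RV P >-> R}) : Prop :=
  finite_moments P X /\
  forall nu : probability R R,
    finite_moments nu id ->
    (forall k, (0 < k)%N -> moment nu id k = moment P X k) ->
    forall A : set R, measurable A -> nu A = distribution P X A.

Definition prod_RV d (T : measurableType d) (R : realType)
    (P : probability T R) (n : nat) (X : 'I_n -> {RV P >-> R}) (t : T) : R :=
  \prod_(i < n) X i t.

Lemma measurable_prod_RV d (T : measurableType d) (R : realType)
    (P : probability T R) (n : nat) (X : 'I_n -> {RV P >-> R}) :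
  measurable_fun [set: T] (prod_RV X).
Proof. by apply: measurable_prod => i _; exact: measurable_funPT. Qed.

HB.instance Definition _ d (T : measurableType d) (R : realType)
    (P : probability T R) (n : nat) (X : 'I_n -> {RV P >-> R}) :=
  isMeasurableFun.Build _ _ T R (prod_RV X) (measurable_prod_RV X).

(* Main.v *)
Require Import Defs.
From HB Require Import structures.
From mathcomp Require Import all_boot all_order all_algebra.
From mathcomp Require Import all_classical all_reals all_analysis.
From mathcomp Require Import measurable_realfun ring.
Import Order.TTheory GRing.Theory Num.Theory.
Import numFieldNormedType.Exports.

Set Implicit Arguments.
Unset Strict Implicit.
Unset Printing Implicit Defensive.

Local Open Scope classical_set_scope.
Local Open Scope ring_scope.

(** By independence the even moments of the product Z of the xi_i are products
    of even moments, so they are at most C (2k)^(2k (a_1 + ... + a_n)), hence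
    at most C (2k)^(2k) [ge0_expectation_prod, bigO_nat_uniform_bound].  As
    k^k / k! <= e^k, the series of E[(hZ)^(2k)] / (2k)! is dominated by a
    geometric one when h = 1/(2e), so the law of Z has a finite exponential
    moment E[exp (h |Z|)]; any law with the same moments inherits it
    [integrable_expR_of_even_moments].

    It remains to see that two laws mu and nu on the line with a common finite
    exponential moment and the same moments are equal.  The classical route
    continues the Fourier transforms analytically and inverts them; the one
    taken here uses only dominated convergence.  Consider the bounded
    measurable functions f such that p f has the same integral under mu and nu
    for every polynomial p.  This class contains 1, it is closed under linear
    combinations and bounded pointwise limits, and it is closed under
    multiplication by x |-> sin (t (x - c)) for t <= h/2: the Taylor polynomials
    of the sine can be absorbed into p, and they are dominated by
    exp (t |x - c|), which the exponential moment controls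
    [moment_matched_sin].  Expanding two exponentials in power series, the
    class contains

      x |-> exp (- m exp (- m sin (t (x - c)) / t)),

    a function with values in [0, 1].  Letting t tend to 0 gives
    exp (- m exp (- m (x - c))), which involves no sine any more, and letting m
    tend to infinity gives the indicator of the ray ]c, +oo[.  So mu and nu
    agree on rays, hence on all Borel sets. *)

(** * Expectations of products of independent variables *)

Section weighted_integral.
Context d d' (T : measurableType d) (T' : measurableType d') (R : realType).
Variables (mu : {measure set T -> \bar R}) (X : {mfun T >-> T'}).
Import HBNNSimple.
Local Open Scope ereal_scope.

(** Approximating g from below by simple functions reduces the claim to
    indicators.  In the induction of ge0_expectation_prod the
    weight w is the product of all the factors but one, and w' is the product
    of their expectations. *)
Lemma ge0_integral_comp_weight (w w' : T -> \bar R) (g : T' -> R) :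
  measurable_fun [set: T] w -> measurable_fun [set: T] w' ->
  (forall x, 0 <= w x) -> (forall x, 0 <= w' x) ->
  (forall x, w x \is a fin_num) -> (forall x, w' x \is a fin_num) ->
  measurable_fun [set: T'] g -> (forall y, 0 <= g y)%R ->
  (forall A, measurable A ->
    \int[mu]_x ((\1_A (X x))%:E * w x) = \int[mu]_x ((\1_A (X x))%:E * w' x)) ->
  \int[mu]_x ((g (X x))%:E * w x) = \int[mu]_x ((g (X x))%:E * w' x).
Proof.
move=> mw mw' w0 w0' fw fw' mg g0 ww'.
have mG : measurable_fun [set: T'] (EFin \o g) by exact/measurable_EFinP.
pose f_ := nnsfun_approx measurableT mG.
have mX : measurable_fun [set: T] X by exact: measurable_funPT.
have mind A : measurable A ->
    measurable_fun [set: T] (fun x => (\1_A (X x))%:E : \bar R).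
  move=> mA; apply/measurable_EFinP; apply: measurableT_comp mX.
  exact: measurable_indic.
(* Both sides are the same limit of sums over the levels of the simple
   functions f_ n. *)
suff limE (v : T -> \bar R) : measurable_fun [set: T] v -> (forall x, 0 <= v x) ->
    (forall x, v x \is a fin_num) ->
    \int[mu]_x ((g (X x))%:E * v x) =
    limn (fun n => \sum_(k \in range (f_ n))
      (k%:E * \int[mu]_x ((\1_(f_ n @^-1` [set k]) (X x))%:E * v x))).
  rewrite !limE//; congr (limn _); apply/funext => n.
  by apply: eq_fsbigr => k _; rewrite ww'.
move=> mv v0 fv.
have mf_v n : measurable_fun [set: T] (fun x => (f_ n (X x))%:E * v x).
  apply: emeasurable_funM => //; apply/measurable_EFinP.
  exact: measurableT_comp mX.
transitivity (limn (fun n => \int[mu]_x ((f_ n (X x))%:E * v x))).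
  rewrite -monotone_convergence//.
  - apply: eq_integral => x _; apply/esym/cvg_lim => //.
    apply: cvgeZr => //=.
    apply: (@cvg_nnsfun_approx _ _ _ _ measurableT _ mG
      (fun y _ => g0 y : 0 <= (EFin \o g) y) (X x) I).
  - by move=> n x _; rewrite mule_ge0// lee_fin.
  - move=> x _ m n mn; rewrite lee_wpmul2r// lee_fin.
    exact/lefP/nd_nnsfun_approx.
congr (limn _); apply/funext => n.
have nn k x : 0 <= k%:E * ((\1_(f_ n @^-1` [set k]) (X x))%:E * v x).
  rewrite muleA mule_ge0// -EFinM; exact: nnfun_muleindic_ge0.
have mk k : measurable_fun [set: T]
    (fun x => k%:E * ((\1_(f_ n @^-1` [set k]) (X x))%:E * v x)).
  by apply: measurable_funeM; apply: emeasurable_funM => //; exact: mind.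
transitivity (\int[mu]_x (\sum_(k \in range (f_ n))
    (k%:E * ((\1_(f_ n @^-1` [set k]) (X x))%:E * v x)))).
  apply: eq_integral => x _; rewrite {1}fimfunE -fsumEFin//.
  rewrite ge0_mule_fsuml; last by move=> k; exact: nnfun_muleindic_ge0.
  by apply: eq_fsbigr => k _; rewrite EFinM muleA.
rewrite ge0_integral_fsum//; apply: eq_fsbigr => k /[!inE] -[y _ <-].
rewrite ge0_integralZl//.
- by apply: emeasurable_funM => //; exact: mind.
- by move=> x _; rewrite mule_ge0// lee_fin.
- by rewrite lee_fin.
Qed.

End weighted_integral.

Section independence.
Context d (T : measurableType d) (R : realType) (P : probability T R) (n : nat).
Variable (X : 'I_n -> {RV P >-> R}).
Hypothesis indep : independent_RVs X.

(** The product rule for events is the case of indicators.  The factors are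
    generalized one at a time: at stage j those of index less than j are
    arbitrary and the others are indicators, and in passing to stage j + 1 the
    factor j is set apart, its indicators being covered by stage j. *)
Lemma ge0_expectation_prod (g : 'I_n -> R -> R) :
  (forall i, measurable_fun [set: R] (g i)) -> (forall i y, 0 <= g i y) ->
  (forall i, \int[P]_x (g i (X i x))%:E < +oo)%E ->
  (\int[P]_x (\prod_(i < n) g i (X i x))%:E =
   \prod_(i < n) \int[P]_x (g i (X i x))%:E)%E.
Proof.
suff H j : forall g : 'I_n -> R -> R,
    (forall i, measurable_fun [set: R] (g i)) -> (forall i y, 0 <= g i y) ->
    (forall i, \int[P]_x (g i (X i x))%:E < +oo)%E ->
    (forall i : 'I_n, (j <= i)%N -> exists2 A, measurable A & g i = \1_A) ->
    (\int[P]_x (\prod_(i < n) g i (X i x))%:E =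
     \prod_(i < n) \int[P]_x (g i (X i x))%:E)%E.
  by move=> mg g0 goo; apply: (H n) => // i; rewrite leqNgt ltn_ord.
elim: j => {g} [|j IH] g mg g0 goo gA.
  have /choice[A hA] : forall i, exists A, measurable A /\ g i = \1_A.
    by move=> i; have [A ? ?] := gA i isT; exists A.
  have mXA i : measurable (X i @^-1` A i).
    by rewrite -[X in measurable X]setTI; apply: measurable_funPT => //; case: (hA i).
  transitivity (P (\bigcap_(i in [set: 'I_n]) X i @^-1` A i)).
    rewrite -[X in P X]setIT -integral_indic//; last first.
      by apply: fin_bigcap_measurable.
    apply: eq_integral => x _; congr EFin.
    rewrite indicE; have [xA|xA] := boolP (x \in _).
      rewrite big1// => i _; rewrite (hA i).2 indicE mem_set//.
      by move: xA; rewrite inE; apply.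
    have [i xAi] : exists i, ~ A i (X i x).
      apply/existsNP => xAi; move/negP : xA; apply; rewrite inE => i _; exact: xAi.
    by rewrite (bigD1 i)//= (hA i).2 indicE memNset// mul0r.
  rewrite indep => [|i]; last by case: (hA i).
  apply: eq_bigr => i _; rewrite -[X in P X]setIT -integral_indic//.
  by apply: eq_integral => x _; rewrite (hA i).2.
have [nj|jn] := leqP n j.
  by apply: IH => // i ji; have := ltn_ord i; rewrite ltnNge (leq_trans nj ji).
pose i0 := Ordinal jn.
pose c := (\prod_(i < n | i != i0) \int[P]_x (g i (X i x))%:E)%E.
have c0 : (0 <= c)%E.
  by apply: prode_ge0 => i _; apply: integral_ge0 => x _; rewrite lee_fin.
have cfin : c \is a fin_num.
  apply: prode_fin_num => i _; rewrite ge0_fin_numE//.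
  by apply: integral_ge0 => x _; rewrite lee_fin.
pose w x := (\prod_(i < n | i != i0) g i (X i x))%:E.
have mgX (f : R -> R) i : measurable_fun [set: R] f ->
    measurable_fun [set: T] (fun x => (f (X i x))%:E).
  by move=> mf; apply/measurable_EFinP; apply: measurableT_comp => //.
have step (f : R -> R) : measurable_fun [set: R] f -> (forall y, 0 <= f y) ->
    (\int[P]_x ((f (X i0 x))%:E * cst c x) = \int[P]_x (f (X i0 x))%:E * c)%E.
  by move=> mf f0; rewrite ge0_integralZr//; [exact: mgX|move=> x _; rewrite lee_fin].
transitivity (\int[P]_x ((g i0 (X i0 x))%:E * w x))%E.
  by apply: eq_integral => x _; rewrite (bigD1 i0)//= EFinM.
rewrite (@ge0_integral_comp_weight _ _ _ _ _ _ _ _ (cst c))//.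
- by rewrite step// [RHS](bigD1 i0).
- apply/measurable_EFinP; under eq_fun do rewrite big_mkcond/=.
  apply: measurable_prod => i _; case: (i != i0) => //.
  by apply: measurableT_comp.
- by move=> x; rewrite lee_fin prodr_ge0.
- move=> A mA; rewrite (step \1_A)//.
  pose g' i := if i == i0 then \1_A else g i.
  have g'E i : i != i0 -> g' i = g i by rewrite /g' => /negbTE ->.
  have g'i0 : g' i0 = \1_A by rewrite /g' eqxx.
  have IHg' : (\int[P]_x (\prod_(i < n) g' i (X i x))%:E =
      \prod_(i < n) \int[P]_x (g' i (X i x))%:E)%E.
    apply: (IH g'); [move=> i|move=> i y|move=> i|move=> i ji].
    - by rewrite /g'; case: (i == i0); [exact: measurable_indic|exact: mg].
    - by rewrite /g'; case: (i == i0) => //; rewrite indicE.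
    - have [->|ii0] := eqVneq i i0; last by rewrite g'E.
      rewrite g'i0; apply: (@le_lt_trans _ _ (\int[P]_x 1%:E)%E).
        apply: ge0_le_integral => //.
        + by apply: mgX; exact: measurable_indic.
        + by move=> x _; rewrite lee_fin indicE lern1 leq_b1.
      by rewrite integral_cst// mul1e (le_lt_trans (probability_le1 _ _))// ltry.
    - have [->|ii0] := eqVneq i i0; first by exists A.
      rewrite g'E//; apply: gA; rewrite ltn_neqAle ji andbT.
      by apply: contra ii0 => /eqP ji'; apply/eqP/val_inj.
  transitivity (\int[P]_x (\prod_(i < n) g' i (X i x))%:E)%E.
    apply: eq_integral => x _; rewrite [in RHS](bigD1 i0)//= g'i0 EFinM.
    by congr (_ * _%:E)%E; apply: eq_bigr => i /g'E ->.
  rewrite IHg' (bigD1 i0)//= g'i0; congr (_ * _)%E.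
  by apply: eq_bigr => i /g'E ->.
Qed.

End independence.

(** * An exponential moment from the growth of the even moments *)

Lemma exprn_div_fact_le_expR (R : realType) k : k%:R ^+ k / k`!%:R <= expR 1 ^+ k :> R.
Proof.
case: k => [|k]; first by rewrite !expr0 fact0 divr1.
rewrite -expRM_natl mulr1.
by rewrite (le_trans _ (expR_ge1Dxn k (ler0n _ k.+1)))// lerDr.
Qed.

(** Since exp |u| <= exp u + exp (- u), it suffices to integrate the power series
    of the right-hand side at u = h x.  Its odd terms cancel and its term of
    even degree k has integral at most 2 C (h e)^k = 2 C 2^(- k). *)
Lemma integrable_expR_of_even_moments (R : realType) (mu : probability R R) (C : R) :
  (forall k, (\int[mu]_x (x ^+ (2 * k))%:E <= (C * (2 * k)%:R ^+ (2 * k))%:E)%E) ->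
  mu.-integrable [set: R] (fun x => (expR ((2 * expR 1)^-1 * `|x|))%:E).
Proof.
move=> mC; set h := (2 * expR 1)^-1.
have h0 : 0 < h by rewrite invr_gt0 mulr_gt0 ?expR_gt0.
have C0 : 0 <= C.
  have := mC 0%N; rewrite muln0 expr0 mulr1 -lee_fin => /(le_trans _); apply.
  by apply: integral_ge0 => x _; rewrite lee_fin expr0.
(* Adding the two series termwise makes all partial sums nonnegative and
   nondecreasing, as monotone convergence requires. *)
pose a k x := exp_coeff (h * x) k + exp_coeff (- (h * x)) k.
have aE k x : a k x = if odd k then 0 else 2 * h ^+ k / k`!%:R * x ^+ k.
  rewrite /a /exp_coeff/= exprNn -signr_odd; case: (odd k).
    by rewrite expr1 mulN1r mulNr subrr.
  by rewrite expr0 mul1r exprMn; ring.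
have a0 k x : 0 <= a k x.
  rewrite aE; case: ifPn => // ek; rewrite mulr_ge0//.
    by rewrite divr_ge0// mulr_ge0// exprn_ge0// ltW.
  by rewrite exprn_even_ge0.
have ma k : measurable_fun [set: R] (a k).
  rewrite (_ : a k = fun x => if odd k then 0 else 2 * h ^+ k / k`!%:R * x ^+ k);
    last by apply/funext => x; rewrite aE.
  case: (odd k) => //.
  by apply: measurable_funM => //; exact: exprn_measurable.
have ia k : (\int[mu]_x (a k x)%:E <= (geometric (2 * C) 2^-1 k)%:E)%E.
  have [ok|ok] := boolP (odd k).
    rewrite integral0_eq; last by move=> x _; rewrite aE ok.
    by rewrite lee_fin /= mulr_ge0 ?mulr_ge0// exprn_ge0.
  under eq_integral do rewrite aE (negbTE ok).
  have ke : k = (2 * k./2)%N by rewrite mul2n even_halfK.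
  under eq_integral do rewrite EFinM.
  rewrite ge0_integralZl//; last 3 first.
  - by apply/measurable_EFinP; exact: exprn_measurable.
  - by move=> x _; rewrite lee_fin exprn_even_ge0.
  - by rewrite lee_fin divr_ge0// mulr_ge0// exprn_ge0// ltW.
  apply: (@le_trans _ _ ((2 * h ^+ k / k`!%:R)%:E * (C * k%:R ^+ k)%:E)%E).
    rewrite lee_wpmul2l//.
      by rewrite lee_fin divr_ge0// mulr_ge0// exprn_ge0// ltW.
    by have := mC k./2; rewrite -ke.
  rewrite -EFinM lee_fin /=.
  rewrite [leLHS](_ : _ = 2 * C * (h ^+ k * (k%:R ^+ k / k`!%:R))); last by ring.
  rewrite ler_wpM2l ?mulr_ge0//.
  apply: (@le_trans _ _ (h ^+ k * expR 1 ^+ k)).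
    by rewrite ler_wpM2l ?exprn_div_fact_le_expR// exprn_ge0// ltW.
  by rewrite -exprMn /h invfM mulfVK// gt_eqF// expR_gt0.
pose F n x := series (a ^~ x) n.
have F0 n x : 0 <= F n x by rewrite /F /series/= sumr_ge0.
have mF n : measurable_fun [set: R] (F n) by exact: measurable_sum.
have ndF x : nondecreasing_seq (F ^~ x).
  by apply/nondecreasing_seqP => n; rewrite /F /series/= big_nat_recr//= lerDl.
have cF x : F n x @[n --> \oo] --> expR (h * x) + expR (- (h * x)).
  rewrite [X in X @ _ --> _](_ : _ = series (exp_coeff (h * x)) \+
     series (exp_coeff (- (h * x)))).
    apply: cvgD; exact: is_cvg_series_exp_coeff.
  by apply/funext => n; rewrite /F /series/= big_split.
have iF n : (\int[mu]_x (F n x)%:E <= (4 * C)%:E)%E.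
  rewrite /F /series/=; under eq_integral do rewrite -sumEFin.
  rewrite ge0_integral_sum//; last 2 first.
  - by move=> k; apply/measurable_EFinP.
  - by move=> k x _; rewrite lee_fin.
  rewrite (@le_trans _ _ (\sum_(0 <= k < n) (geometric (2 * C) 2^-1 k)%:E)%E)//.
    by rewrite lee_sum.
  rewrite sumEFin lee_fin.
  rewrite [leLHS](_ : _ = series (geometric (2 * C) 2^-1) n)//.
  rewrite geometric_seriesE; last first.
    by rewrite lt_eqF// invf_lt1// ltr1n.
  rewrite /= (_ : 4 * C = 2 * C / (1 - 2^-1)); last by field.
  rewrite ler_wpM2r//; first by rewrite invr_ge0 subr_ge0 invf_le1// ler1n.
  by rewrite ler_piMr ?mulr_ge0// gerBl exprn_ge0.
have icosh : mu.-integrable [set: R] (fun x => (expR (h * x) + expR (- (h * x)))%:E).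
  have mcosh : measurable_fun [set: R] (fun x => expR (h * x) + expR (- (h * x))).
    by apply: (@measurable_fun_cvg _ _ _ _ F) => // x _; exact: cF.
  apply/integrableP; split; first exact/measurable_EFinP.
  apply: (@le_lt_trans _ _ (4 * C)%:E); last exact: ltry.
  under eq_integral do rewrite gee0_abs ?lee_fin ?addr_ge0 ?expR_ge0//.
  have cI : (\int[mu]_x (F n x)%:E @[n --> \oo] -->
       \int[mu]_x (limn (fun n => (F n x)%:E)))%E.
    apply: cvg_monotone_convergence => //.
    - by move=> n; apply/measurable_EFinP.
    - by move=> n x _; rewrite lee_fin.
    - by move=> x _ m n mn; rewrite lee_fin; exact: ndF.
  have -> : (\int[mu]_x (expR (h * x) + expR (- (h * x)))%:E =
       \int[mu]_x (limn (fun n => (F n x)%:E)))%E.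
    apply: eq_integral => x _; apply/esym/cvg_lim => //.
    by apply/fine_cvgP; split; [exact: nearW|exact: cF].
  rewrite -(cvg_lim _ cI)//; apply: lime_le; first exact: (cvgP _ cI).
  exact: nearW.
apply: le_integrable icosh => //.
  apply/measurable_EFinP; apply: measurableT_comp => //.
  by apply: measurable_funM => //; exact: measurableT_comp.
move=> x _ /=; rewrite lee_fin ger0_norm ?expR_ge0// (le_trans _ (ler_norm _))//.
case: (ger0P x) => _; first by rewrite lerDl expR_ge0.
by rewrite mulrN lerDr expR_ge0.
Qed.

(** * Bounds on Taylor polynomials and on polynomials *)

Lemma series_exp_coeff_le_expR (R : realType) (x : R) n :
  `|series (exp_coeff x) n| <= expR `|x|.
Proof.
apply: (@le_trans _ _ (series (exp_coeff `|x|) n)).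
  rewrite -normed_series_exp_coeff; exact: ler_norm_sum.
apply: nondecreasing_cvgn_le; last exact: is_cvg_series_exp_coeff.
apply/nondecreasing_seqP => k; rewrite /series/= big_nat_recr//= lerDl.
by rewrite exp_coeff_ge0.
Qed.

Lemma series_sin_coeff_le_expR (R : realType) (x : R) n :
  `|series (sin_coeff x) n| <= expR `|x|.
Proof.
apply: (@le_trans _ _ (series (exp_coeff `|x|) n)); last first.
  rewrite (le_trans (ler_norm _))// (le_trans (series_exp_coeff_le_expR _ _))//.
  by rewrite normr_id.
rewrite (le_trans (ler_norm_sum _ _ _))// ler_sum// => k _.
rewrite /sin_coeff/= /exp_coeff/= !normrM normfV normrX normr_nat.
rewrite normrX normrN1 expr1n mulr1 [`|_`!%:R|]normr_nat -mulrA.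
by rewrite ler_piMl ?divr_ge0 ?exprn_ge0// lern1 leq_b1.
Qed.

(** In passing from p to p X + c the rate t is split in two halves, one for p
    and one for the new factor |x| <= exp (t/2 |x|) / (t/2). *)
Lemma horner_le_expR (R : realType) (p : {poly R}) (t : R) : 0 < t ->
  exists K, forall x, `|p.[x]| <= K * expR (t * `|x|).
Proof.
elim/poly_ind: p t => [|p c IH] t t0.
  by exists 0 => x; rewrite horner0 normr0 mul0r.
have t20 : 0 < t / 2 by rewrite divr_gt0.
have [K hK] := IH _ t20.
have K0 : 0 <= K.
  by have := le_trans (normr_ge0 _) (hK 0); rewrite normr0 mulr0 expR0 mulr1.
exists (K * (t / 2)^-1 + `|c|) => x.
rewrite hornerMXaddC (le_trans (ler_normD _ _))// mulrDl lerD//; last first.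
  by rewrite ler_peMr// -expR0 ler_expR mulr_ge0// ltW.
rewrite normrM (_ : t * `|x| = t / 2 * `|x| + t / 2 * `|x|); last by field.
rewrite expRD (_ : K * _ * _ = K * expR (t / 2 * `|x|) *
  ((t / 2)^-1 * expR (t / 2 * `|x|))); last by ring.
rewrite ler_pM// mulrC ler_pdivlMr// mulrC.
by rewrite (le_trans _ (expR_ge1Dx _))// lerDr.
Qed.

(** * Functions that two laws with the same moments do not distinguish *)

Section same_integral.
Context (R : realType) (mu nu : probability R R).
Implicit Types (f g : R -> R) (p : {poly R}).

Definition same_integral f :=
  [/\ mu.-integrable [set: R] (EFin \o f), nu.-integrable [set: R] (EFin \o f) &
      (\int[mu]_x (f x)%:E = \int[nu]_x (f x)%:E)%E].

Lemma same_integralZ a f : same_integral f -> same_integral (fun x => a * f x).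
Proof.
move=> [if1 if2 e]; split; [exact: (integrableZl _ _ if1)|
  exact: (integrableZl _ _ if2)|].
under eq_integral do rewrite EFinM.
rewrite (integralZl _ if1)//=; under [in RHS]eq_integral do rewrite EFinM.
by rewrite (integralZl _ if2)//= e.
Qed.

Lemma same_integralD f g : same_integral f -> same_integral g ->
  same_integral (fun x => f x + g x).
Proof.
move=> [if1 if2 e] [ig1 ig2 e']; split;
  [exact: (integrableD _ if1 ig1)|exact: (integrableD _ if2 ig2)|].
under eq_integral do rewrite EFinD.
rewrite (integralD _ if1 ig1)//=; under [in RHS]eq_integral do rewrite EFinD.
by rewrite (integralD _ if2 ig2)//= e e'.
Qed.

Lemma same_integral_lim (f_ : nat -> R -> R) f g :
  mu.-integrable [set: R] (EFin \o g) -> nu.-integrable [set: R] (EFin \o g) ->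
  (forall n, same_integral (f_ n)) -> (forall n x, `|f_ n x| <= g x) ->
  (forall x, f_ n x @[n --> \oo] --> f x) -> same_integral f.
Proof.
move=> ig1 ig2 sf fg cf.
have mf_ n : measurable_fun [set: R] (f_ n).
  by case: (sf n) => /measurable_int/measurable_EFinP.
have mf : measurable_fun [set: R] f.
  by apply: (measurable_fun_cvg mf_) => x _; exact: cf.
have DCT (m : probability R R) : m.-integrable [set: R] (EFin \o g) ->
    m.-integrable [set: R] (EFin \o f) /\
    (\int[m]_x (f_ n x)%:E @[n --> \oo] --> \int[m]_x (f x)%:E)%E.
  move=> ig; have [|||||? _ ?] := @dominated_convergence _ _ _ m _ measurableT
    (fun n => EFin \o f_ n) (EFin \o f) (EFin \o g) => //.
  - by move=> n; apply/measurable_EFinP.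
  - exact/measurable_EFinP.
  - by apply: aeW => x _; apply/fine_cvgP; split; [exact: nearW|exact: cf].
  - by apply: aeW => x n _; rewrite /= lee_fin.
have [if1 c1] := DCT _ ig1.
have [if2 c2] := DCT _ ig2.
split => //; apply: (cvg_unique _ c1) => //.
apply: cvg_trans c2; apply: near_eq_cvg; apply: nearW => n.
by case: (sf n).
Qed.

(** The factor p is what makes the class stable under multiplication by a sine:
    a Taylor polynomial of the sine is absorbed into p. *)
Definition moment_matched f :=
  [/\ measurable_fun [set: R] f, exists M, forall x, `|f x| <= M &
      forall p, same_integral (fun x => p.[x] * f x)].

Variable h : R.
Hypothesis h0 : 0 < h.
Hypothesis exp_mu : mu.-integrable [set: R] (fun x => (expR (h * `|x|))%:E).
Hypothesis exp_nu : nu.-integrable [set: R] (fun x => (expR (h * `|x|))%:E).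

Local Notation matched := moment_matched.

Lemma moment_matched_lin a f g : matched f -> matched g ->
  matched (fun x => a * f x + g x).
Proof.
move=> [mf [M fM] sf] [mg [N gN] sg]; split.
- by apply: measurable_funD => //; exact: measurable_funM.
- exists (`|a| * M + N) => x; rewrite (le_trans (ler_normD _ _))// lerD//.
  by rewrite normrM ler_wpM2l.
- move=> p; have := same_integralD (same_integralZ a (sf p)) (sg p).
  by congr same_integral; apply/funext => x; ring.
Qed.

Lemma moment_matched_lim (f_ : nat -> R -> R) f (M : R) : (forall n, matched (f_ n)) ->
  (forall n x, `|f_ n x| <= M) -> (forall x, f_ n x @[n --> \oo] --> f x) -> matched f.
Proof.
move=> If_ fM cf; split.
- apply: (@measurable_fun_cvg _ _ _ _ f_) => [n|x _]; last exact: cf.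
  by case: (If_ n).
- exists M => x; have /(_ _) cnf := cvg_norm (cf x).
  rewrite -(cvg_lim _ cnf)//; apply: limr_le; first exact: (cvgP _ cnf).
  exact: nearW.
- move=> p; have [K hK] := horner_le_expR p h0.
  apply: (@same_integral_lim (fun n x => p.[x] * f_ n x) _
    (fun x => K * M * expR (h * `|x|))).
  + exact: (integrableZl measurableT (K * M) exp_mu).
  + exact: (integrableZl measurableT (K * M) exp_nu).
  + by move=> n; case: (If_ n).
  + by move=> n x; rewrite normrM mulrAC ler_pM.
  + by move=> x; exact: cvgMl_tmp.
Qed.

(** The integrand p f S_n, where S_n is a Taylor polynomial of the sine, is
    dominated by a multiple of exp (h/2 |x|) exp (t |x - c|), where the first
    factor bounds p; as t <= h/2 this is at most a multiple of exp (h |x|). *)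
Lemma moment_matched_sin f c t : 0 < t -> t <= h / 2 -> matched f ->
  matched (fun x => f x * sin (t * (x - c))).
Proof.
move=> t0 th [mf [M fM] sf].
have M0 : 0 <= M := le_trans (normr_ge0 _) (fM 0).
split.
- apply: measurable_funM => //; apply: measurableT_comp.
    by apply: continuous_measurable_fun; exact: continuous_sin.
  by apply: measurable_funM => //; exact: measurable_funB.
- exists M => x; rewrite normrM -[leRHS]mulr1 ler_pM//.
  by rewrite ler_norml sin_geN1 sin_le1.
- move=> p; have h20 : 0 < h / 2 by rewrite divr_gt0.
  have [K hK] := horner_le_expR p h20.
  have K0 : 0 <= K.
    by have := le_trans (normr_ge0 _) (hK 0); rewrite normr0 mulr0 expR0 mulr1.
  pose S n : {poly R} := \sum_(0 <= k < n) ((odd k)%:R * (-1) ^+ k.-1./2 / k`!%:R) *: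
     (t *: ('X - c%:P)) ^+ k.
  have SE n x : (S n).[x] = series (sin_coeff (t * (x - c))) n.
    rewrite /S horner_sum; apply: eq_bigr => k _.
    by rewrite /sin_coeff/= hornerZ horner_exp hornerZ hornerXsubC; ring.
  pose B := K * M * expR (h / 2 * `|c|).
  apply: (@same_integral_lim (fun n x => (p * S n).[x] * f x) _
    (fun x => B * expR (h * `|x|))).
  + exact: (integrableZl measurableT B exp_mu).
  + exact: (integrableZl measurableT B exp_nu).
  + by move=> n; exact: sf.
  + move=> n x; rewrite hornerM !normrM SE.
    rewrite mulrAC (_ : B * _ =
      (K * expR (h / 2 * `|x|) * M) * expR (h / 2 * (`|x| + `|c|))); last first.
      rewrite mulrDr [_ * `|x|](_ : _ = h / 2 * `|x| + h / 2 * `|x|); last by field.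
      by rewrite !expRD /B; ring.
    rewrite ler_pM// ?mulr_ge0//.
      by rewrite ler_pM.
    rewrite (le_trans (series_sin_coeff_le_expR _ _))// ler_expR normrM.
    by rewrite ler_pM// ?ler_normB// gtr0_norm.
  + move=> x; under eq_fun do rewrite hornerM SE -mulrA [_ * f x]mulrC.
    apply: cvgMl_tmp; apply: cvgMl_tmp; rewrite unlock; exact: is_cvg_series_sin_coeff.
Qed.

(** The bound on g makes the partial sums of the exponential series uniformly
    bounded. *)
Lemma moment_matched_expR g B a : (forall x, `|g x| <= B) ->
  (forall k, matched (fun x => g x ^+ k)) -> matched (fun x => expR (a * g x)).
Proof.
move=> gB Ig; apply: (@moment_matched_lim (fun n x => series (exp_coeff (a * g x)) n) _
    (expR (`|a| * B))).
- have matched0 : matched (fun=> 0).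
    have := moment_matched_lin (-1) (Ig 0) (Ig 0); congr matched; apply/funext => x.
    by rewrite mulN1r addNr.
  elim=> [|n IH].
    by under eq_fun do rewrite /series/= big_geq//.
  have := moment_matched_lin (a ^+ n / n`!%:R) (Ig n) IH.
  congr matched; apply/funext => x.
  by rewrite [RHS]/series/= big_nat_recr//= addrC /exp_coeff/= exprMn; congr +%R; ring.
- move=> n x; rewrite (le_trans (series_exp_coeff_le_expR _ _))// ler_expR.
  by rewrite normrM ler_wpM2l.
- by move=> x; exact: is_cvg_series_exp_coeff.
Qed.

End same_integral.

(** * Uniqueness of a law with an exponential moment *)

Lemma cvg_sin_div (R : realType) (t : R^nat) (y : R) :
  (forall n, t n != 0) -> t n @[n --> \oo] --> 0 ->
  sin (t n * y) / t n @[n --> \oo] --> y.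
Proof.
move=> t0 tc.
have [->|y0] := eqVneq y 0.
  rewrite [X in X @ _ --> _](_ : _ = cst 0); first exact: cvg_cst.
  by apply/funext => n; rewrite mulr0 sin0 mul0r.
have D := is_derive_sin (0:R).
have /(_ _) := @ex_derive _ _ _ _ _ _ _ D.
move=> /cvg_ex [l hl].
have := @derive_val _ _ _ _ _ _ _ D; rewrite /derive (cvg_lim _ hl)// cos0 => l1.
rewrite {}l1 {l} in hl.
move/cvgr_dnbhsP : hl => /(_ (fun n => t n * y)).
move=> /(_ _)/wrap [].
  split; first by move=> n; rewrite mulf_neq0.
  by rewrite -[X in _ --> X](mul0r y); exact: cvgMl.
move=> h.
rewrite [X in X @ _ --> _](_ : _ =
    (fun n => (t n * y)^-1 *: ((sin \o shift 0) (t n * y)%:A - sin 0) * y)); last first.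
  apply/funext => n /=; rewrite sin0 subr0 addr0 /GRing.scale/= mulr1.
  by field; rewrite y0 t0.
by rewrite -[X in _ --> X]mul1r; apply: cvgMr_tmp.
Qed.

Lemma probability_eq_of_rays (R : realType) (m1 m2 : probability R R) :
  (forall c, m1 `]c, +oo[%classic = m2 `]c, +oo[%classic) ->
  forall A : set R, measurable A -> m1 A = m2 A.
Proof.
move=> h A mA.
apply: (measure_unique (@RGenOInfty.G R) (fun n => `](-n%:R), +oo[%classic)) => //.
- exact: RGenOInfty.measurableE.
- move=> _ _ [x ->] [y ->]; exists (Num.max x y).
  apply/seteqP; split => z /=; rewrite !in_itv/= !andbT gt_max.
    by move=> [-> ->].
  by case/andP.
- by move=> n; exists (-n%:R).
- apply/seteqP; split => // x _; exists (Num.truncn `|x|).+1 => //=.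
  rewrite in_itv/= andbT ltrNl (le_lt_trans (ler_norm _))// normrN.
  exact: truncnS_gt.
- by move=> _ [x ->]; exact: h.
- by move=> k; rewrite (le_lt_trans (probability_le1 _ _)) ?ltry.
Qed.

(** These are Gumbel distribution functions, of scale 1 / (n + 1); at y = 0 they
    tend to 0, so that the limit is the indicator of an open ray. *)
Lemma cvg_gumbel (R : realType) (y : R) :
  expR (- n.+1%:R * expR (- n.+1%:R * y)) @[n --> \oo] --> ((0 < y)%R%:R : R).
Proof.
case: ltP => y0 /=.
  apply: (@squeeze_cvgr _ _ _ _ (fun n => 1 - 2 / y ^+ 2 * harmonic n) (cst 1)).
  - apply: nearW => n; apply/andP; split; last first.
      by rewrite -expR0 ler_expR mulNr oppr_le0 mulr_ge0 ?expR_ge0.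
    rewrite (le_trans _ (expR_ge1Dx _))// mulNr lerB// !mulNr expRN.
    rewrite ler_pdivrMr ?expR_gt0//.
    have : (n.+1%:R * y) ^+ 2 / 2 <= expR (n.+1%:R * y).
      have ny0 : 0 <= n.+1%:R * y by rewrite mulr_ge0// ltW.
      by rewrite (le_trans _ (expR_ge1Dxn 1 ny0))// lerDr.
    have K0 : 0 <= 2 / y ^+ 2 * harmonic n.
      by rewrite mulr_ge0 ?divr_ge0 ?exprn_ge0 ?(ltW y0)// harmonic_ge0.
    move=> /(ler_wpM2l K0).
    apply: le_trans; rewrite /harmonic/= exprMn le_eqVlt; apply/orP; left.
    by apply/eqP; field; rewrite (gt_eqF y0) andbT nat1r pnatr_eq0.
  - rewrite -[X in _ --> X]subr0 -(mulr0 (2 / y ^+ 2)).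
    apply: cvgB; first exact: cvg_cst.
    by apply: cvgMl_tmp; exact: cvg_harmonic.
  - exact: cvg_cst.
apply: (@squeeze_cvgr _ _ _ _ (cst 0) (@harmonic R)).
- apply: nearW => n; rewrite expR_ge0/= mulNr expRN lef_pV2 ?posrE ?expR_gt0//.
  rewrite (@le_trans _ _ (n.+1%:R * expR (- n.+1%:R * y)))//.
    by rewrite ler_peMr// -expR0 ler_expR mulNr oppr_ge0 mulr_ge0_le0.
  by rewrite (le_trans _ (expR_ge1Dx _))// lerDr.
- exact: cvg_cst.
- exact: cvg_harmonic.
Qed.

Section ray.
Context (R : realType) (mu nu : probability R R) (h : R).
Hypothesis h0 : 0 < h.
Hypothesis exp_mu : mu.-integrable [set: R] (fun x => (expR (h * `|x|))%:E).
Hypothesis exp_nu : nu.-integrable [set: R] (fun x => (expR (h * `|x|))%:E).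
Local Notation matched := (moment_matched mu nu).
Hypothesis matched1 : matched (fun=> 1).

(** The powers of the sine are matched, hence so is exp (a sine) for every a;
    the powers of the latter are again of this form, so a second exponential
    can be taken. *)
Lemma moment_matched_gumbel_sin c t a b : 0 < t -> t <= h / 2 ->
  matched (fun x => expR (b * expR (a * sin (t * (x - c))))).
Proof.
move=> t0 th.
have sinX k : matched (fun x => sin (t * (x - c)) ^+ k).
  elim: k => [|k IH]; first by under eq_fun do rewrite expr0.
  by under eq_fun do rewrite exprSr; exact: (moment_matched_sin h0).
have sin1 x : `|sin (t * (x - c))| <= 1 by rewrite ler_norml sin_geN1 sin_le1.
apply: (@moment_matched_expR _ _ _ _ h0 exp_mu exp_nu _ (expR `|a|)) => [x|k].
  rewrite ger0_norm ?expR_ge0// ler_expR (le_trans (ler_norm _))// normrM.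
  by rewrite ler_piMr.
under eq_fun do rewrite -expRM_natl mulrA.
exact: (@moment_matched_expR _ _ _ _ h0 exp_mu exp_nu _ 1 (k%:R * a) sin1 sinX).
Qed.

(** The double exponential is bounded by 1 whatever sits inside, so
    sin (t (x - c)) / t can be replaced by its limit x - c as t tends to 0,
    although x - c is unbounded. *)
Lemma moment_matched_gumbel c m : 0 <= m ->
  matched (fun x => expR (- m * expR (- m * (x - c)))).
Proof.
move=> m0; pose t n := h / 2 / n.+1%:R.
have t0 n : 0 < t n by rewrite !divr_gt0.
apply: (@moment_matched_lim _ _ _ _ h0 exp_mu exp_nu
  (fun n x => expR (- m * expR (- m / t n * sin (t n * (x - c))))) _ 1).
- move=> n; apply: moment_matched_gumbel_sin => //.
  by rewrite /t ler_pdivrMr// ler_peMr ?divr_ge0 ?(ltW h0)// ler1n.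
- move=> n x; rewrite ger0_norm ?expR_ge0// -[leRHS]expR0 ler_expR mulNr oppr_le0.
  by rewrite mulr_ge0 ?expR_ge0.
- move=> x; apply: continuous_cvg; first exact: continuous_expR.
  apply: cvgMl_tmp; apply: continuous_cvg; first exact: continuous_expR.
  under eq_fun do rewrite -mulrA [_^-1 * _]mulrC.
  apply: cvgMl_tmp; apply: cvg_sin_div => [n|]; first by rewrite gt_eqF.
  rewrite -[X in _ --> X](mulr0 (h / 2)); apply: cvgMl_tmp; exact: cvg_harmonic.
Qed.

Lemma ray_eq_of_moment_matched1 c : mu `]c, +oo[%classic = nu `]c, +oo[%classic.
Proof.
have [_ _ /(_ 1)] : matched (\1_(`]c, +oo[%classic)).
  apply: (@moment_matched_lim _ _ _ _ h0 exp_mu exp_nu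
    (fun n x => expR (- n.+1%:R * expR (- n.+1%:R * (x - c)))) _ 1).
  - by move=> n; exact: moment_matched_gumbel.
  - move=> n x; rewrite ger0_norm ?expR_ge0// -[leRHS]expR0 ler_expR mulNr oppr_le0.
  - move=> x; have := @cvg_gumbel R (x - c); rewrite subr_gt0.
    by rewrite indicE mem_setE in_itv/= andbT.
case=> _ _; under eq_integral do rewrite hornerC mul1r.
under [in RHS]eq_integral do rewrite hornerC mul1r.
by rewrite !integral_indic// !setIT.
Qed.

End ray.

Lemma law_determined_of_expR_integrable (R : realType) (mu nu : probability R R)
    (h : R) :
  0 < h ->
  mu.-integrable [set: R] (fun x => (expR (h * `|x|))%:E) ->
  nu.-integrable [set: R] (fun x => (expR (h * `|x|))%:E) ->
  (forall k, same_integral mu nu (fun x => x ^+ k)) ->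
  forall A : set R, measurable A -> mu A = nu A.
Proof.
move=> h0 imu inu mom; apply: probability_eq_of_rays => c.
apply: (ray_eq_of_moment_matched1 h0 imu inu).
split; first exact: measurable_cst.
  by exists 1 => x; rewrite normr1.
move=> p; under eq_fun do rewrite mulr1 horner_coef.
elim: (size p) => [|n IH].
  under eq_fun do rewrite big_ord0.
  by have := same_integralZ 0 (mom 0); under eq_fun do rewrite mul0r.
under eq_fun do rewrite big_ord_recr/=.
exact: same_integralD IH (same_integralZ _ (mom n)).
Qed.

(** * Moment determinacy *)

Lemma integrable_horner (R : realType) (mu : probability R R) (h : R) (p : {poly R}) :
  0 < h -> mu.-integrable [set: R] (fun x => (expR (h * `|x|))%:E) ->
  mu.-integrable [set: R] (fun x => p.[x]%:E).
Proof.
move=> h0 imu; have [K hK] := horner_le_expR p h0.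
apply: le_integrable (integrableZl measurableT K imu) => //.
  by apply/measurable_EFinP; exact: measurable_poly.
by move=> x _ /=; rewrite lee_fin (le_trans (hK x))// ler_norm.
Qed.

Lemma integrable_distribution d (T : measurableType d) (R : realType)
    (P : probability T R) (X : {RV P >-> R}) (f : R -> R) :
  (distribution P X).-integrable [set: R] (EFin \o f) ->
  P.-integrable [set: T] (fun t => (f (X t))%:E).
Proof.
move=> /integrableP[mf foo].
have mX : measurable_fun [set: T] X by exact: measurable_funPT.
apply/integrableP; split; first exact: measurableT_comp mf mX.
move: foo; rewrite ge0_integral_distribution//.
exact: measurableT_comp.
Qed.

(** The terms before the asymptotic regime are absorbed into the constant, since
    v stays away from 0. *)
Lemma bigO_nat_uniform_bound (R : realType) (u v : nat -> R) :
  (forall k, 0 <= u k) -> (forall k, 1 <= v k) ->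
  (u : nat -> R^o) =O_\oo (v : nat -> R^o) -> exists C, forall k, u k <= C * v k.
Proof.
move=> u0 v1 /eqO_exP[K K0 [N _ uv]].
exists (K + \sum_(k < N) u k) => k.
have S0 : 0 <= \sum_(k < N) u k by rewrite sumr_ge0.
have [kN|Nk] := ltnP k N; last first.
  have := uv k Nk; rewrite /= !ger0_norm// ?(le_trans ler01 (v1 k))//.
  by move=> /le_trans; apply; rewrite ler_wpM2r ?lerDl// (le_trans ler01 (v1 k)).
rewrite (@le_trans _ _ (K + \sum_(k < N) u k))// ?ler_peMr ?addr_ge0 ?(ltW K0)//.
rewrite (bigD1 (Ordinal kN))//= addrCA lerDl addr_ge0 ?(ltW K0)//.
by rewrite sumr_ge0.
Qed.

(** The law of X and a competitor have the same even moments, so they share the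
    exponential moment of exponent 1/(2e), which determines them. *)
Lemma M_det_of_even_moments d (T : measurableType d) (R : realType)
    (P : probability T R) (X : {RV P >-> R}) (C : R) :
  (forall k, (\int[P]_t (X t ^+ (2 * k))%:E <= (C * (2 * k)%:R ^+ (2 * k))%:E)%E) ->
  M_det X.
Proof.
move=> XC; pose mu := distribution P X.
have mu_even k : (\int[mu]_x (x ^+ (2 * k))%:E <= (C * (2 * k)%:R ^+ (2 * k))%:E)%E.
  rewrite ge0_integral_distribution//; first exact: XC.
  - by apply/measurable_EFinP; exact: exprn_measurable.
  - by move=> x; rewrite lee_fin exprn_even_ge0// oddM.
have h0 : 0 < (2 * expR 1)^-1 :> R by rewrite invr_gt0 mulr_gt0 ?expR_gt0.
have imu := integrable_expR_of_even_moments mu_even.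
have ipow (m : probability R R) k :
    m.-integrable [set: R] (fun x => (expR ((2 * expR 1)^-1 * `|x|))%:E) ->
    m.-integrable [set: R] (EFin \o (fun x => x ^+ k)).
  move=> /(integrable_horner 'X^k h0); apply: eq_integrable => // x _ /=.
  by rewrite hornerXn.
have iX k : P.-integrable [set: T] (fun t => (X t ^+ k)%:E).
  exact: (integrable_distribution (ipow _ k imu)).
split => [k _|nu _ mom]; first exact: iX.
have E k : (\int[nu]_x (x ^+ k)%:E = \int[mu]_x (x ^+ k)%:E)%E.
  case: k => [|k].
    have mass1 (m : probability R R) : (\int[m]_x (x ^+ 0)%:E = 1)%E.
      under eq_integral do rewrite expr0.
      by rewrite integral_cst// mul1e; exact: probability_setT.
    by rewrite !mass1.
  have := mom k.+1 isT; rewrite /moment unlock => ->.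
  rewrite integral_distribution//; last exact: iX.
  by apply/measurable_EFinP; exact: exprn_measurable.
have inu : nu.-integrable [set: R] (fun x => (expR ((2 * expR 1)^-1 * `|x|))%:E).
  by apply: (@integrable_expR_of_even_moments _ _ C) => k; rewrite E.
apply: (law_determined_of_expR_integrable h0 inu imu) => k.
by split; [exact: ipow|exact: ipow|exact: E].
Qed.

(** The rates (2k)^(2 a_i k) multiply to a power of 2k whose exponent is at most
    2k because the a_i sum to at most 1. *)
Theorem theorem8 (d : measure_display) (T : measurableType d) (R : realType)
    (P : probability T R) (n : nat) (hn : (0 < n)%N)
    (xi : 'I_n -> {RV P >-> R}) (a : 'I_n -> R)
    (hindep : independent_RVs xi)
    (hfin : forall i, finite_moments P (xi i))
    (ha : forall i, 0 < a i)
    (hO : forall i,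
      (fun k : nat => fine (moment P (xi i) (2 * k)%N) : R^o) =O_\oo
      (fun k : nat => (2 * k)%:R `^ (2 * a i * k%:R) : R^o))
    (hsum : \sum_(i < n) a i <= 1) :
  M_det (prod_RV xi : {RV P >-> R}).
Proof.
have pow_ge0 i k t : 0 <= xi i t ^+ (2 * k) by rewrite exprn_even_ge0// oddM.
have int_ge0 i k : (0 <= \int[P]_t (xi i t ^+ (2 * k))%:E)%E.
  by apply: integral_ge0 => t _; rewrite lee_fin.
have int_lty i k : (\int[P]_t (xi i t ^+ (2 * k))%:E < +oo)%E.
  case: k => [|k]; last by apply: integrable_lty => //; apply: hfin; rewrite mulnS.
  under eq_integral do rewrite expr0.
  by rewrite integral_cst// mul1e (le_lt_trans (probability_le1 _ _)) ?ltry.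
have rate_ge1 i k : 1 <= (2 * k)%:R `^ (2 * a i * k%:R) :> R.
  case: k => [|k]; first by rewrite mulr0 powRr0.
  rewrite -[leLHS](powRr0 (2 * k.+1)%:R) ler_powR ?ler1n//.
  by rewrite !mulr_ge0// ltW.
have /choice[C hC] i : exists C, forall k,
    fine (\int[P]_t (xi i t ^+ (2 * k))%:E) <= C * (2 * k)%:R `^ (2 * a i * k%:R).
  apply: bigO_nat_uniform_bound => // [k|]; first exact/fine_ge0/int_ge0.
  by have := hO i; rewrite /moment unlock.
apply: (@M_det_of_even_moments _ _ _ _ _ (\prod_(i < n) C i)) => k.
rewrite [leLHS](_ : _ = \int[P]_t (\prod_(i < n) (xi i t ^+ (2 * k)))%:E)%E; last first.
  by apply: eq_integral => t _; rewrite /prod_RV prodrXl.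
rewrite (ge0_expectation_prod hindep (g := fun _ y => y ^+ (2 * k)))//; last first.
  by move=> i y; rewrite exprn_even_ge0// oddM.
under eq_bigr => i _ do rewrite -(@fineK _ (\int[P]_t _)%E) ?ge0_fin_numE//.
rewrite prodEFin lee_fin.
apply: (@le_trans _ _ (\prod_(i < n) (C i * (2 * k)%:R `^ (2 * a i * k%:R)))).
  by apply: ler_prod => i _; rewrite hC andbT; exact/fine_ge0/int_ge0.
have C0 i : 0 <= C i.
  rewrite -(@pmulr_lge0 _ ((2 * 0)%:R `^ (2 * a i * 0%:R))).
    by apply: le_trans (hC i 0%N); exact/fine_ge0/int_ge0.
  exact: lt_le_trans (rate_ge1 i 0%N).
rewrite big_split/= ler_wpM2l ?prodr_ge0//.
case: k => [|k].
  by rewrite muln0 expr0 big1// => i _; rewrite mulr0 powRr0.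
have k0 : 0 < (2 * k.+1)%:R :> R by rewrite ltr0n.
rewrite (_ : \prod_(i < n) _ =
    (2 * k.+1)%:R `^ (\sum_(i < n) (2 * a i * k.+1%:R))); last first.
  rewrite (big_morph (powR (2 * k.+1)%:R) (id1 := 1) (op1 := *%R))//.
  - by move=> x y; rewrite powRD// (gt_eqF k0) implybT.
  - by rewrite powRr0.
rewrite -(powR_mulrn _ (ltW k0)).
apply: ler_powR; first by rewrite ler1n.
by rewrite -mulr_suml -mulr_sumr natrM mulrAC ler_piMr//.
Qed.
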